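(* Let $N\ge 1$, and let $(\lambda_1,\ldots,\lambda_N,w_1,\ldots,w_N)$ be real numbers with $0<\lambda_1<\cdots<\lambda_N<\infty$, $w_j>0$ for all $j$, and $\sum_{j=1}^N w_j=1$. Then there exist positive numbers $a_1,\ldots,a_N$ and $b_1,\ldots,b_{N-1}$ such that, as an identity of rational functions in $z$, $$\sum_{j=1}^N\frac{w_j}{z-\lambda_j}=\cfrac{1}{z-a_1-\cfrac{b_1z}{z-a_2-\cfrac{b_2z}{z-a_3-\cdots-\cfrac{b_{N-1}z}{z-a_N}}}}.$$
   Context: For $N=1$ the right-hand side is $1/(z-a_1)$. *)

(* Defs.v *)
From mathcomp Require Import all_boot all_order all_algebra.
From mathcomp Require Import reals.

Set Implicit Arguments.
Unset Strict Implicit.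
Unset Printing Implicit Defensive.

Import Order.TTheory GRing.Theory Num.Theory.

Local Open Scope ring_scope.

(* The field R(z): {fraction {poly R}}, with z the image of 'X. *)
Definition zvar (R : realType) : {fraction {poly R}} :=
  @FracField.tofrac {poly R} 'X.

Definition zconst (R : realType) (c : R) : {fraction {poly R}} :=
  @FracField.tofrac {poly R} c%:P.

(* For a = [:: a_1; ...; a_N] and b = [:: b_1; ...; b_(N-1)], the expression
     z - a_1 - b_1 z / (z - a_2 - b_2 z / (... - b_(N-1) z / (z - a_N))).
   The value for an empty a is junk: it is not reached when
   size a = (size b).+1.  In that case no division by zero occurs either: each
   nested denominator is a quotient of monic polynomials whose degrees differ
   by one. *)
Fixpoint cfrac_den (R : realType) (a b : seq R) : {fraction {poly R}} :=
  match a, b with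
  | [::], _ => 0
  | x :: _, [::] => zvar R - zconst x
  | x :: a', y :: b' =>
      zvar R - zconst x - (zconst y * zvar R) / cfrac_den a' b'
  end.

Definition cfrac (R : realType) (a b : seq R) : {fraction {poly R}} :=
  1 / cfrac_den a b.

(* Main.v *)
(* Write the sum as P / Q with Q = \prod (z - lambda_j); P alternates in sign at
   the decreasingly ordered lambda_j, so its roots are real and interlace them.
   The Euclidean-like step Q = (z - a) P - z S, with a = - Q(0) / P(0) > 0 chosen
   so that the remainder vanishes at 0, gives S (mu) = - Q (mu) / mu at every root
   mu of P.  Hence S alternates in sign at the roots of P, its leading coefficient
   is positive, and S / P is, up to that coefficient, a fraction of the same kind
   with one pole less: induct. *)
Require Import Defs.
From mathcomp Require Import all_boot all_order all_algebra.
From mathcomp Require Import reals.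

Set Implicit Arguments.
Unset Strict Implicit.

Import Order.TTheory GRing.Theory Num.Theory.

Local Open Scope ring_scope.

Lemma size_prod_XsubC_ord (R : idomainType) (n : nat) (y : nat -> R) :
  size (\prod_(i < n) ('X - (y i)%:P)) = n.+1.
Proof. by rewrite -(big_mkord xpredT (fun i => 'X - (y i)%:P)) size_prod_XsubC size_iota subn0. Qed.

(** Exactly the first [i] factors are negative. *)
Lemma sign_prod_sub (R : realDomainType) (n i : nat) (t : R) (y : nat -> R) :
  (i <= n)%N ->
  (forall j, (j < i)%N -> t < y j) ->
  (forall j, (i <= j < n)%N -> y j < t) ->
  0 < (-1) ^+ i * \prod_(j < n) (t - y j).
Proof.
elim: n i y => [|n IHn] [|i] y // le_in lt_ty lt_yt.
- by rewrite big_ord0 expr0 mulr1 ltr01.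
- rewrite expr0 mul1r; apply: prodr_gt0 => j _.
  by rewrite subr_gt0; apply: lt_yt => /=.
rewrite big_ord_recl exprS mulrACA mulN1r opprB.
rewrite mulr_gt0 //; first by rewrite subr_gt0; apply: lt_ty.
by apply: (IHn i (y \o S)) => // j /= hj; [apply: lt_ty | apply: lt_yt].
Qed.

Lemma sign_change_roots (R : rcfType) (n : nat) (x : nat -> R) (P : {poly R}) :
  (forall i j, (i < j <= n)%N -> x j < x i) ->
  (forall i, (i <= n)%N -> 0 < (-1) ^+ i * P.[x i]) ->
  exists y : nat -> R,
    forall i, (i < n)%N -> [/\ x i.+1 < y i, y i < x i & root P (y i)].
Proof.
move=> x_decr signP.
have rootP (i : 'I_n) : exists r, [/\ x i.+1 < r, r < x i & root P r].
  have lt_x : x i.+1 < x i by apply: x_decr; rewrite ltnSn ltn_ord.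
  have s0 := signP i (ltnW (ltn_ord i)).
  have s1 := signP i.+1 (ltn_ord i).
  (* The sign makes [Q] negative at the left end [x i.+1] and positive at the right end [x i], as
     the intermediate value theorem requires. *)
  pose Q := (-1) ^+ i *: P.
  have Q0 : 0 < Q.[x i] by rewrite hornerZ.
  have Q1 : Q.[x i.+1] < 0.
    by move: s1; rewrite exprS mulN1r mulNr oppr_gt0 hornerZ.
  have [r /andP[xr rx] Qr] :=
    poly_ivt (ltW lt_x) (introT andP (conj (ltW Q1) (ltW Q0))).
  exists r; split.
  - rewrite lt_neqAle xr andbT; apply/eqP => e.
    by move: Q1; rewrite e (rootP Qr) ltxx.
  - rewrite lt_neqAle rx andbT; apply/eqP => e.
    by move: Q0; rewrite -e (rootP Qr) ltxx.
  - by move: Qr; rewrite rootZ // signr_eq0.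
have [f hf] := fin_all_exists rootP.
exists (fun i => if insub i is Some j then f j else 0) => i lt_in.
by rewrite insubT; apply: (hf (Ordinal lt_in)).
Qed.

(** The [n] gaps between consecutive [x i] are disjoint, so the roots found there are distinct and
    exhaust the degree of [P]. *)
Lemma interlacing_factorization (R : rcfType) (n : nat) (x : nat -> R)
    (P : {poly R}) :
  (forall i j, (i < j <= n)%N -> x j < x i) ->
  (size P <= n.+1)%N ->
  (forall i, (i <= n)%N -> 0 < (-1) ^+ i * P.[x i]) ->
  exists y : nat -> R,
    [/\ forall i, (i < n)%N -> x i.+1 < y i < x i,
        0 < P`_n & P = P`_n *: \prod_(i < n) ('X - (y i)%:P)].
Proof.
move=> x_decr szP signP.
have [y y_int] := sign_change_roots x_decr signP; exists y.
have y_decr i j : (i < j < n)%N -> y j < y i.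
  case/andP=> ij jn; have [_ yx _] := y_int j jn.
  have [xy _ _] := y_int i (ltn_trans ij jn).
  apply: lt_trans yx (le_lt_trans _ xy).
  move: ij; rewrite leq_eqVlt => /orP[/eqP-> //|ij].
  by rewrite ltW // x_decr // ij ltnW.
pose s := [seq y i | i <- iota 0 n].
have prod_s : \prod_(z <- s) ('X - z%:P) = \prod_(i < n) ('X - (y i)%:P).
  by rewrite big_map -[n in iota 0 n]subn0 big_mkord.
have uniq_s : uniq s.
  rewrite map_inj_in_uniq ?iota_uniq // => i j.
  rewrite !mem_iota !add0n /= => lin ljn e.
  by case: (ltngtP i j) => // ij; [have := y_decr i j | have := y_decr j i];
    rewrite ij ?lin ?ljn e ltxx => /(_ isT).
have P_neq0 : P != 0.
  by apply/eqP => P0; have := signP 0 isT; rewrite P0 horner0 mulr0 ltxx.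
have root_s : all (root P) s.
  apply/allP => _ /mapP[i i_n ->]; rewrite mem_iota in i_n.
  by case: (y_int i i_n).
have size_s : size s = n by rewrite size_map size_iota.
have szPE : size P = n.+1.
  apply/eqP; rewrite eqn_leq szP /= -size_s.
  by apply: max_poly_roots.
have PE : P = P`_n *: \prod_(i < n) ('X - (y i)%:P).
  rewrite -prod_s [LHS](@all_roots_prod_XsubC _ _ s) ?size_s //.
  - by rewrite lead_coefE szPE.
  - by rewrite uniq_rootsE.
split=> //; first by move=> i /y_int[-> ->].
(* [x 0] lies to the right of every root, so the leading coefficient has the sign of [P.[x 0]]. *)
have := signP 0 isT.
rewrite expr0 mul1r {1}PE hornerZ horner_prod pmulr_lgt0 //.
apply: prodr_gt0 => -[i lt_in] _; rewrite hornerXsubC subr_gt0 /=.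
have [_ yx _] := y_int i lt_in; apply: lt_le_trans yx _.
case: (posnP i) => [-> //|i_gt0].
by rewrite ltW // x_decr // i_gt0 ltnW.
Qed.

(* Letting P be non-monic makes the statement inductive: the next b is the
   leading coefficient of the next numerator. *)
Lemma stieltjes_cfrac (R : realType) (n : nat) (x : nat -> R) (P : {poly R}) :
  (forall i j, (i < j <= n)%N -> x j < x i) ->
  0 < x n ->
  (size P <= n.+1)%N ->
  (forall i, (i <= n)%N -> 0 < (-1) ^+ i * P.[x i]) ->
  exists a b : seq R,
    [/\ size a = n.+1, size b = n,
        all (fun c => 0 < c) a, all (fun c => 0 < c) b &
        FracField.tofrac P /
          FracField.tofrac (\prod_(i < n.+1) ('X - (x i)%:P))
        = zconst P`_n * cfrac a b].
Proof.
elim: n x P => [|n IHn] x P x_decr x_gt0 szP signP.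
  exists [:: x 0], [::]; split=> //=; first by rewrite x_gt0.
  rewrite big_ord1 /cfrac /= mul1r /zconst /zvar -rmorphB /=.
  by congr (_ / _); rewrite {1}(size1_polyC szP).
have [y [y_int P_lead PE]] := interlacing_factorization x_decr szP signP.
(* [lt_xy] and [lt_yx] extend the interlacing from neighbours to all index pairs: [y j < x i] when
   [i <= j], and [x i < y j] when [j < i]. *)
have lt_xy j i : (j <= n)%N -> (i < j)%N || (i == j) -> y j < x i.
  move=> jn /orP[ij|/eqP->]; last by case/andP: (y_int j jn).
  case/andP: (y_int j jn) => _ /lt_trans; apply.
  by rewrite x_decr // ij ltnW.
have lt_yx j i : (i <= n.+1)%N -> (j < i)%N -> x i < y j.
  move=> i_n ji; case/andP: (y_int j (leq_trans ji i_n)) => xy _.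
  apply: le_lt_trans xy; move: ji; rewrite leq_eqVlt => /orP[/eqP-> //|ji].
  by rewrite ltW // x_decr // ji.
have y_decr i j : (i < j <= n)%N -> y j < y i.
  case/andP=> ij jn; apply: lt_trans (lt_xy j j jn _) (lt_yx i j _ ij).
    by rewrite eqxx orbT.
  exact: leqW.
have y_gt0 : 0 < y n by apply: lt_trans x_gt0 (lt_yx _ _ _ _).
(* [P0] is [P] made monic, so that the leading terms cancel in the division step. *)
pose P0 := \prod_(i < n.+1) ('X - (y i)%:P).
pose Q := \prod_(i < n.+2) ('X - (x i)%:P).
have P0E t : P0.[t] = \prod_(i < n.+1) (t - y i).
  by rewrite horner_prod; apply: eq_bigr => i _; rewrite hornerXsubC.
have QE t : Q.[t] = \prod_(i < n.+2) (t - x i).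
  by rewrite horner_prod; apply: eq_bigr => i _; rewrite hornerXsubC.
(* All roots are positive, so every linear factor is negative at 0. The degrees of [P0] and [Q]
   differ by one, so their values at 0 have opposite signs and [a0] is positive. *)
have P0_at0 : 0 < (-1) ^+ n.+1 * P0.[0].
  rewrite P0E; apply: sign_prod_sub => // j; last first.
    by case/andP=> /leq_ltn_trans lt_j /lt_j; rewrite ltnn.
  rewrite ltnS leq_eqVlt => /orP[/eqP-> //|jn].
  by apply: lt_trans y_gt0 (y_decr _ _ _); rewrite jn leqnn.
have Q_at0 : 0 < (-1) ^+ n.+2 * Q.[0].
  rewrite QE; apply: sign_prod_sub => // j; last first.
    by case/andP=> /leq_ltn_trans lt_j /lt_j; rewrite ltnn.
  rewrite ltnS leq_eqVlt => /orP[/eqP-> //|jn].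
  by apply: lt_trans x_gt0 (x_decr _ _ _); rewrite jn leqnn.
have P0_0neq0 : P0.[0] != 0.
  by apply: contraTneq P0_at0 => ->; rewrite mulr0 ltxx.
pose a0 := - Q.[0] / P0.[0].
have a0_gt0 : 0 < a0.
  suff -> : a0 = ((-1) ^+ n.+2 * Q.[0]) / ((-1) ^+ n.+1 * P0.[0]).
    exact: divr_gt0.
  rewrite [(-1) ^+ n.+2]exprSr -(mulrA _ (-1)) mulN1r -mulf_div.
  by rewrite divff ?signr_eq0 // mul1r.
have a0E : a0 * P0.[0] = - Q.[0] by rewrite divfK.
clearbody a0.
have szP0 : size P0 = n.+2 by rewrite size_prod_XsubC_ord.
have szQ : size Q = n.+3 by rewrite size_prod_XsubC_ord.
have [S SE] : exists S, ('X - a0%:P) * P0 - Q = S * 'X.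
  have /factor_theorem[S ->] : root (('X - a0%:P) * P0 - Q) 0.
    rewrite /root hornerD hornerN hornerM hornerXsubC sub0r mulNr a0E.
    by rewrite opprK subrr.
  by exists S; rewrite subr0.
have P0_monic : P0 \is monic by apply: monic_prod_XsubC.
have Q_monic : Q \is monic by apply: monic_prod_XsubC.
(* A difference of two monic polynomials of size [n.+3] has size at most [n.+2]; dividing by ['X]
   removes one more. *)
have szS : (size S <= n.+1)%N.
  have [->|S0] := eqVneq S 0; first by rewrite size_poly0.
  rewrite -ltnS -(size_mulX S0) -SE.
  have XP_monic : ('X - a0%:P) * P0 \is monic by rewrite monicMl ?monicXsubC.
  have szXP : size (('X - a0%:P) * P0) = n.+3.
    by rewrite size_monicM ?monicXsubC ?monic_neq0 // size_XsubC szP0.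
  apply/leq_sizeP => j; rewrite leq_eqVlt => /orP[/eqP <-|lt_j].
    rewrite coefB -[n.+2]/(n.+3.-1) -{1}szXP -szQ -!lead_coefE.
    by rewrite !(monicP _) // subrr.
  by rewrite coefB !nth_default ?subrr ?szXP ?szQ.
have signS i : (i <= n)%N -> 0 < (-1) ^+ i * S.[y i].
  move=> i_n.
  have y_i : 0 < y i.
    move: i_n; rewrite leq_eqVlt => /orP[/eqP-> //|i_n].
    by apply: lt_trans y_gt0 (y_decr _ _ _); rewrite i_n leqnn.
  (* Exactly [x 0], ..., [x i] exceed [y i]. The minus sign in [S.[y i] * y i = - Q.[y i]] then
     turns the exponent [i.+1] into [i]. *)
  have Qy : 0 < (-1) ^+ i.+1 * Q.[y i].
    rewrite QE; apply: sign_prod_sub; first exact: leqW.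
    - by move=> j; rewrite ltnS leq_eqVlt orbC; apply: lt_xy.
    - by move=> j /andP[ij jn]; apply: lt_yx.
  have P0y : P0.[y i] = 0.
    by rewrite P0E (bigD1 (Ordinal (i_n : (i < n.+1)%N))) //= subrr mul0r.
  have : S.[y i] * y i = - Q.[y i].
    rewrite -[S.[y i] * y i]hornerMX -SE hornerD hornerN hornerM P0y.
    by rewrite mulr0 sub0r.
  move=> e; rewrite -(pmulr_lgt0 _ y_i) -mulrA e mulrN -mulNr.
  by rewrite -mulN1r -exprS.
have [a [b [sz_a sz_b a_gt0 b_gt0 fracE]]] := IHn y S y_decr y_gt0 szS signS.
(* Only the positivity of the leading coefficient of [S], the new entry of [b], is taken from
   here. *)
have [_ [_ S_lead _]] := interlacing_factorization y_decr szS signS.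
exists (a0 :: a), (S`_n :: b); split=> /=; rewrite ?sz_a ?sz_b ?a0_gt0 //.
  by rewrite S_lead.
have tofrac_monic (p : {poly R}) : p \is monic -> FracField.tofrac p != 0.
  by move=> /monic_neq0; rewrite tofrac_eq0.
(* With the leading coefficient of [P] cancelled and both sides inverted, it remains to expand
   [Q / P0] as [z - a0 - z * (S / P0)], where the induction hypothesis gives [S / P0]. *)
rewrite {1}PE -mul_polyC rmorphM /= /cfrac -mulrA; congr (_ * _).
rewrite div1r -invf_div; congr (_^-1).
rewrite -/Q -/P0 in fracE *.
have -> : Q = ('X - a0%:P) * P0 - S * 'X by rewrite -SE opprB addrC subrK.
rewrite rmorphB mulrBl (rmorphM _ _ P0) mulfK ?tofrac_monic //.
rewrite rmorphB rmorphM /=; congr (_ - _).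
by rewrite mulrAC fracE /cfrac -/(zvar R) div1r mulrAC.
Qed.

Theorem theorem2p8 (R : realType) (N : nat) (lam w : N.-tuple R) :
  (1 <= N)%N ->
  path <%R 0 lam ->
  (forall j : 'I_N, 0 < tnth w j) ->
  \sum_(j < N) tnth w j = 1 ->
  exists (a : N.-tuple R) (b : N.-1.-tuple R),
    [/\ forall i : 'I_N, 0 < tnth a i,
        forall i : 'I_N.-1, 0 < tnth b i &
        \sum_(j < N) zconst (tnth w j) / (zvar R - zconst (tnth lam j))
          = cfrac a b].
Proof.
case: N lam w => // n lam w _ lam_path w_gt0 w_sum.
have lam_sorted : {in [pred i | (i < n.+1)%N] &,
    {homo nth 0 lam : i j / (i < j)%N >-> i < j}}.
  move=> i j; rewrite !inE => lin ljn; apply: (sorted_ltn_nth lt_trans);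
    rewrite ?inE ?size_tuple //; exact: path_sorted lam_path.
(* The preceding lemmas take their nodes in decreasing order, hence the reversal, which [v] repeats
   for the weights. *)
pose x i : R := nth 0 lam (n - i).
have x_decr i j : (i < j <= n)%N -> x j < x i.
  case/andP=> ij jn; apply: lam_sorted; rewrite ?inE ?ltnS ?leq_subr //.
  by rewrite ltn_sub2l // (leq_trans ij).
have x_gt0 : 0 < x n.
  have /allP := order_path_min lt_trans lam_path; apply.
  by rewrite mem_nth // size_tuple ltnS leq_subr.
pose v (i : 'I_n.+1) := tnth w (rev_ord i).
(* [bump i] skips the index [i], so [cof i] is [Q] without its factor at [x i], and [P] is the
   numerator of the sum over the denominator [Q]. *)
pose cof (i : 'I_n.+1) : {poly R} := \prod_(k < n) ('X - (x (bump i k))%:P).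
pose Q := \prod_(i < n.+1) ('X - (x i)%:P).
have QE (i : 'I_n.+1) : Q = ('X - (x i)%:P) * cof i by rewrite /Q (bigD1_ord i).
pose P := \sum_(i < n.+1) v i *: cof i.
have sz_cof (i : 'I_n.+1) : size (cof i) = n.+1.
  by rewrite (size_prod_XsubC_ord _ (fun k => x (bump i k))).
have szP : (size P <= n.+1)%N.
  apply: (leq_trans (size_sum _ _ _)); apply/bigmax_leqP => i _.
  by apply: leq_trans (size_scale_leq _ _) _; rewrite sz_cof.
(* The cofactors are monic, so the leading coefficient is the total weight; this makes the prefactor
   of the continued fraction 1. *)
have P_lead : P`_n = 1.
  rewrite coef_sum -w_sum (reindex_inj rev_ord_inj); apply: eq_bigr => i _.
  rewrite coefZ /v rev_ordK.
  have /monicP : cof (rev_ord i) \is monic by apply: monic_prod_XsubC.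
  by rewrite lead_coefE sz_cof => ->; rewrite mulr1.
have P_x (i : 'I_n.+1) : P.[x i] = v i * \prod_(k < n) (x i - x (bump i k)).
  rewrite horner_sum (bigD1 i) //= big1 ?addr0 => [|j ne_ji].
    rewrite hornerZ horner_prod; congr (_ * _).
    by apply: eq_bigr => k _; rewrite hornerXsubC.
  rewrite hornerZ /cof horner_prod.
  have [k ->] := unlift_some ne_ji.
  by rewrite (bigD1 k) //= hornerXsubC subrr mul0r mulr0.
(* Only [cof i] survives at [x i], and its first [i] factors are the negative ones. *)
have signP i : (i <= n)%N -> 0 < (-1) ^+ i * P.[x i].
  move=> i_n; rewrite -[i]/(nat_of_ord (Ordinal (i_n : (i < n.+1)%N))) P_x /=.
  rewrite mulrCA mulr_gt0 ?w_gt0 //.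
  apply: (@sign_prod_sub _ n i (x i) (x \o bump i)) => // j /= hj.
    by rewrite /bump leqNgt hj x_decr // hj.
  by case/andP: hj => ij jn; rewrite /bump ij x_decr // ltnS ij.
have [a [b [sz_a sz_b a_gt0 b_gt0 fracE]]] :=
  stieltjes_cfrac x_decr x_gt0 szP signP.
have size_aP : size a == n.+1 by apply/eqP.
have size_bP : size b == n.+1.-1 by apply/eqP.
exists (Tuple size_aP), (Tuple size_bP); split=> [i|i|].
- exact: (allP a_gt0) (mem_tnth i (Tuple size_aP)).
- exact: (allP b_gt0) (mem_tnth i (Tuple size_bP)).
rewrite /= -[RHS]mul1r -[X in X * _](rmorph1 (@FracField.tofrac {poly R})).
have -> : (1 : {poly R}) = (P`_n)%:P by rewrite P_lead.
rewrite -/(zconst P`_n) -fracE -/Q rmorph_sum mulr_suml.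
rewrite (reindex_inj rev_ord_inj); apply: eq_bigr => i _ /=.
rewrite -mul_polyC rmorphM /= (QE i) rmorphM /=.
have cof_neq0 : FracField.tofrac (cof i) != 0.
  by rewrite tofrac_eq0 -size_poly_eq0 sz_cof.
rewrite -mulf_div divff // mulr1 rmorphB /= (tnth_nth 0 lam) /=.
by rewrite subSS.
Qed.
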